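(* Let $(\Phi_n)_{n=1}^\infty$ be a non-autonomous iterated function system in $\mathbb{R}^d$ satisfying the open set condition. Then the bounded neighbourhood condition holds if any of the following conditions are satisfied: (a) The IFS satisfies the cone condition and has bounded branching. (b) The IFS is homogeneous and has bounded branching. (c) The IFS has contraction ratios uniformly bounded away from $0$: there is a constant $r_{\min}>0$ such that $r_{n,j}\ge r_{\min}$ for all $n\in\mathbb{N}$ and $j\in\mathcal{J}_n$.
   Context: **Non-autonomous IFS.** Let $\mathbb{N}=\{1,2,\ldots\}$ and work in Euclidean $\mathbb{R}^d$. For each $n\in\mathbb{N}$ let $\mathcal{J}_n$ be a finite index set with $\#\mathcal{J}_n\ge 2$ and let $\Phi_n=\{S_{n,j}\}_{j\in\mathcal{J}_n}$ be an indexed family of maps $S_{n,j}(x)=r_{n,j}O_{n,j}x+d_{n,j}$ on $\mathbb{R}^d$, where $r_{n,j}\in(0,1)$, $O_{n,j}$ is an orthogonal matrix and $d_{n,j}\in\mathbb{R}^d$. The sequence $(\Phi_n)_{n=1}^\infty$ is a non-autonomous iterated function system (IFS) if there is a non-empty compact set $X\subset\mathbb{R}^d$ that is invariant, i.e. $S_{n,j}(X)\subset X$ for all $n\in\mathbb{N}$, $j\in\mathcal{J}_n$, and $$\lim_{n\to\infty}\sup\{r_{1,j_1}\cdots r_{n,j_n}: j_i\in\mathcal{J}_i,\ i=1,\ldots,n\}=0.$$ Its limit set is the non-empty compact set $$K=\bigcap_{n=1}^\infty\bigcup_{(j_1,\ldots,j_n)\in\mathcal{J}_1\times\cdots\times\mathcal{J}_n}S_{1,j_1}\circ\cdots\circ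 S_{n,j_n}(X).$$ The IFS is homogeneous if for each $n$ there is a number $r_n$ with $r_{n,j}=r_n$ for all $j\in\mathcal{J}_n$. **Symbolic space.** Let $\Delta=\prod_{n=1}^\infty\mathcal{J}_n$. For $n\ge 0$, let $\mathcal{T}_n$ be the set of cylinders $[j_1,\ldots,j_n]=\{j_1\}\times\cdots\times\{j_n\}\times\prod_{k>n}\mathcal{J}_k$ with $j_i\in\mathcal{J}_i$ (so $\mathcal{T}_0=\{\Delta\}$), and $\mathcal{T}=\bigcup_{n\ge 0}\mathcal{T}_n$. For $Q=[j_1,\ldots,j_n]$ put $\rho(Q)=r_{1,j_1}\cdots r_{n,j_n}$ (with $\rho(\Delta)=1$), and if $Q\ne\Delta$ let $\widehat{Q}=[j_1,\ldots,j_{n-1}]$ be its parent. For $r>0$ let $\mathcal{T}(r)=\{Q\in\mathcal{T}\setminus\{\Delta\}:\rho(Q)\le r<\rho(\widehat{Q})\}$. The coding map $\pi:\Delta\to\mathbb{R}^d$ is defined by $\{\pi((i_n)_{n=1}^\infty)\}=\bigcap_{n=1}^\infty S_{1,i_1}\circ\cdots\circ S_{n,i_n}(X)$; it satisfies $\pi(\Delta)=K$. **Bounded neighbourhood condition.** For $x\in K$ and $r>0$, let $\mathcal{N}(x,r)=\{Q\in\mathcal{T}(r):\pi(Q)\cap B(x,r)\ne\varnothing\}$, where $B(x,r)$ is the closed ball. The IFS satisfies the bounded neighbourhood condition if $\limsup_{r\to0}\sup_{x\in K}\#\mathcal{N}(x,r)<\infty$. **Open set condition and cone condition.** The IFS satisfies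 the open set condition if the invariant compact set $X$ can be chosen to have non-empty interior $U=X^\circ$ such that for each $n\in\mathbb{N}$ and $j\ne j'$ in $\mathcal{J}_n$, $S_{n,j}(U)\cap S_{n,j'}(U)=\varnothing$. It moreover satisfies the cone condition if (for this $X$ and $U$) $\inf_{x\in X}\inf_{r\in(0,1)}r^{-d}\mathcal{L}^d(B(x,r)\cap U)>0$, where $\mathcal{L}^d$ is $d$-dimensional Lebesgue measure. **Bounded branching.** For $r>0$ let $\beta(r)=\sup_{Q\in\mathcal{T}(r)}\#\{Q'\in\mathcal{T}(r):Q'\subset\widehat{Q}\}$. The IFS has bounded branching if $\limsup_{r\to0}\beta(r)<\infty$. *)

(* Defs.v *)
From HB Require Import structures.
From mathcomp Require Import all_boot all_order all_algebra.
From mathcomp Require Import all_classical all_reals all_analysis.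

Set Implicit Arguments.
Unset Strict Implicit.
Unset Printing Implicit Defensive.

Import Order.TTheory GRing.Theory Num.Theory.
Import numFieldNormedType.Exports.

Local Open Scope classical_set_scope.
Local Open Scope ring_scope.

(* R^d is 'cV[R]_d. The library norm on matrices is the sup norm; it induces the
   Euclidean topology (so `compact` and `interior` are the usual notions), but
   balls have to be taken for the Euclidean norm. *)
Section EuclideanSpace.
Context {R : realType} {d : nat}.
Implicit Types (x a b : 'cV[R]_d) (A : set 'cV[R]_d).

Definition enorm x : R := Num.sqrt (\sum_(i < d) x i ord0 ^+ 2).

Definition eball x (r : R) : set 'cV[R]_d := closed_ball_ enorm x r.

Definition box a b : set 'cV[R]_d :=
  [set x | forall i, a i ord0 < x i ord0 <= b i ord0].

Definition box_volume a b : R := \prod_(i < d) (b i ord0 - a i ord0).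

(* d-dimensional Lebesgue (outer) measure, d >= 1: infimum of the total volume
   over all countable covers by (possibly empty) boxes. *)
Definition lebesgueRd A : \bar R :=
  ereal_inf [set s | exists a b : nat -> 'cV[R]_d,
    [/\ forall k i, a k i ord0 <= b k i ord0,
        A `<=` \bigcup_k box (a k) (b k)
      & s = (\sum_(0 <= k <oo) (box_volume (a k) (b k))%:E)%E]].

End EuclideanSpace.

(* Levels are numbered from 0: level n here is level n+1 in the 1-based
   numbering of the systems Phi_1, Phi_2, ... *)
Record simseq (R : realType) (d : nat) := SimSeq {
  idx : nat -> finType;
  ratio : forall n, idx n -> R;
  orth : forall n, idx n -> 'M[R]_d;
  transl : forall n, idx n -> 'cV[R]_d;
  card_idx : forall n, (2 <= #|idx n|)%N;
  ratio_itv : forall n (j : idx n), 0 < ratio j < 1;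
  orth_orthogonal : forall n (j : idx n), (orth j)^T *m orth j = 1%:M
}.

Section NonAutonomousIFS.
Context {R : realType} {d : nat} (Phi : simseq R d).
Implicit Types (X : set 'cV[R]_d) (r : R).

Definition sim n (j : idx Phi n) (x : 'cV[R]_d) : 'cV[R]_d :=
  ratio j *: (orth j *m x) + transl j.

(* Words j_1 ... j_n, built by appending letters on the right. *)
Fixpoint word (n : nat) : finType :=
  if n is m.+1 then (word m * idx Phi m)%type else unit.

Fixpoint word_ratio n : word n -> R :=
  if n is m.+1 then fun w => word_ratio w.1 * ratio w.2 else fun=> 1.

Fixpoint word_sim n : word n -> 'cV[R]_d -> 'cV[R]_d :=
  if n is m.+1 then fun w => word_sim w.1 \o sim w.2 else fun=> id.

Definition invariant_compact X :=
  [/\ X !=set0, compact X & forall n (j : idx Phi n), sim j @` X `<=` X].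

Definition vanishing_ratios :=
  sup [set word_ratio w | w in [set: word n]] @[n --> \oo] --> (0 : R).

Definition nonautonomous_ifs X := invariant_compact X /\ vanishing_ratios.

Definition limit_set X : set 'cV[R]_d :=
  \bigcap_n \bigcup_(w in [set: word n.+1]) (word_sim w @` X).

Definition homogeneous :=
  forall n, exists rn : R, forall j : idx Phi n, ratio j = rn.

Definition Delta := forall n, idx Phi n.

Fixpoint word_prefix (i : Delta) n : word n :=
  if n is m.+1 then (word_prefix i m, i m) else tt.

(* A cylinder is represented by its defining word. As every index set has at
   least two elements, distinct words give distinct subsets of Delta, so
   counting words is counting cylinders. *)
Definition cylinder := {n : nat & word n}.

Definition cyl_set (Q : cylinder) : set Delta :=
  [set i | word_prefix i (tag Q) = tagged Q].

Definition rho (Q : cylinder) : R := word_ratio (tagged Q).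

(* The parent of Delta itself is never used; it is Delta by convention. *)
Definition parent (Q : cylinder) : cylinder :=
  let: existT n w := Q in
  match n return word n -> cylinder with
  | m.+1 => fun w => Tagged word w.1
  | 0 => fun w => Tagged word w
  end w.

Definition scale_cut r : set cylinder :=
  [set Q | (0 < tag Q)%N /\ rho Q <= r < rho (parent Q)].

(* For a nonautonomous IFS the intersection is a singleton, and its element does
   not depend on the choice of the invariant compact set X. *)
Definition coding X (i : Delta) : 'cV[R]_d :=
  xget 0 (\bigcap_n (word_sim (word_prefix i n.+1) @` X)).

Definition neighbours X (x : 'cV[R]_d) r : set cylinder :=
  [set Q | scale_cut r Q /\ coding X @` cyl_set Q `&` eball x r !=set0].

Definition bounded_neighbourhood_condition X : Prop :=
  (limf_esup
     (fun r => ereal_sup [set counting (neighbours X x r) | x in limit_set X])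
     (0 : R)^'+ < +oo :> \bar R)%E.

Definition osc_set X :=
  [/\ invariant_compact X, interior X !=set0
    & forall n (j j' : idx Phi n), j != j' ->
        sim j @` interior X `&` sim j' @` interior X = set0].

Definition open_set_condition := exists X, osc_set X.

Definition cone_condition :=
  exists2 X, osc_set X &
    (0 < ereal_inf [set ereal_inf
           [set (r ^- d)%:E * lebesgueRd (eball x r `&` interior X)
             | r in [set r | (0 < r < 1)%R]]
         | x in X])%E.

Definition branching r : \bar R :=
  ereal_sup
    [set counting [set Q' | scale_cut r Q' /\ cyl_set Q' `<=` cyl_set (parent Q)]
      | Q in scale_cut r].

Definition bounded_branching : Prop :=
  (limf_esup branching (0 : R)^'+ < +oo)%E.

Definition ratios_bounded_below :=
  exists2 rmin : R, 0 < rmin & forall n (j : idx Phi n), rmin <= ratio j.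

End NonAutonomousIFS.

(* Main.v *)
(* Let Y be the compact set of the open set condition and U its interior. If
   cylinders P are pairwise disjoint, so are the sets S_P(U); hence if each of
   them occupies a fixed proportion of one ball, their number is bounded. When
   the ratios are bounded below this applies to the neighbours of a point
   themselves, each S_Q(U) containing a ball of radius comparable to r. Otherwise
   it applies to the maximal parents of the neighbours, each of which has a
   bounded number of descendants in T(r) by bounded branching: in a homogeneous
   system these parents all have the same ratio, larger than r, and in general
   the cone condition, rescaled by S_P, says that S_P(U) fills a fixed proportion
   of a ball of radius r around a point of S_P(Y).

   Volumes are compared by counting points of fine lattices. For the cone
   condition this requires replacing an open set by finitely many disjoint dyadic
   cells of almost the same Lebesgue measure, because a similarity may rotate the
   boxes that define the measure. *)
Require Import Defs.
From HB Require Import structures.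
From mathcomp Require Import all_boot all_order all_algebra finmap.
From mathcomp Require Import all_classical all_reals all_analysis.
From mathcomp Require Import lra ring zify.

Set Implicit Arguments.
Unset Strict Implicit.
Unset Printing Implicit Defensive.

Import Order.TTheory GRing.Theory Num.Theory.
Import numFieldNormedType.Exports.

Local Open Scope classical_set_scope.
Local Open Scope ring_scope.

(** * Norms and similarities *)

Section Norms.
Context {R : realType} {d : nat}.
Implicit Types (x y : 'cV[R]_d).

Lemma coord_le_norm x i : `|x i ord0| <= `|x|.
Proof.
by rewrite [leRHS]/Num.Def.normr/= mx_normrE; apply/bigmax_geP; right; exists (i, ord0).
Qed.

Lemma norm_le_coord x (M : R) :
  0 <= M -> (forall i, `|x i ord0| <= M) -> `|x| <= M.
Proof.
move=> M0 xM; rewrite [leLHS]/Num.Def.normr/= mx_normrE.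
by apply/bigmax_leP; split => // -[i j] _ /=; rewrite (ord1 j).
Qed.

Lemma enorm_ge0 x : 0 <= enorm x.
Proof. exact: sqrtr_ge0. Qed.

Lemma norm_le_enorm x : `|x| <= enorm x.
Proof.
apply: norm_le_coord; first exact: enorm_ge0.
move=> i; rewrite -sqrtr_sqr ler_wsqrtr// (bigD1 i)//= lerDl.
by apply: sumr_ge0 => j _; exact: sqr_ge0.
Qed.

Lemma enorm_le_norm x : enorm x <= d%:R * `|x|.
Proof.
rewrite -(ger0_norm (mulr_ge0 (ler0n R d) (normr_ge0 x))) -sqrtr_sqr ler_wsqrtr//.
apply: (@le_trans _ _ (\sum_(i < d) `|x| ^+ 2)).
  apply: ler_sum => i _; rewrite -[leLHS]real_normK ?num_real//.
  by rewrite lerXn2r ?nnegrE// coord_le_norm.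
rewrite sumr_const card_ord -[leLHS]mulr_natl exprMn ler_wpM2r ?sqr_ge0//.
by rewrite -natrX ler_nat; case: d => // n; rewrite leq_pmull.
Qed.

End Norms.

Section Similarity.
Context {R : realType} {d : nat}.
Implicit Types (x y : 'cV[R]_d) (f g : 'cV[R]_d -> 'cV[R]_d) (A : set 'cV[R]_d).

(** Surjectivity is required because it makes the image of a ball contain the whole ball of scaled
    radius, hence keeps images of open sets open. *)
Definition similarity (c : R) f :=
  (forall x y, enorm (f x - f y) = c * enorm (x - y)) /\
  (forall y, exists x, f x = y).

Lemma similarity_id : similarity 1 id.
Proof. by split=> [x y|y]; [rewrite mul1r|exists y]. Qed.

Lemma similarity_comp b c f g :
  similarity b f -> similarity c g -> similarity (b * c) (f \o g).
Proof.
move=> [fe fs] [ge gs]; split=> [x y /=|y]; first by rewrite fe ge mulrA.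
by have [x <-] := fs y; have [z <-] := gs x; exists z.
Qed.

Lemma similarity_inj c f : 0 < c -> similarity c f -> injective f.
Proof.
move=> c0 [fe _] x y fxy; have /esym/eqP := fe x y.
have -> : enorm (f x - f y) = 0.
  by rewrite fxy subrr /enorm big1 ?sqrtr0// => i _; rewrite mxE expr0n.
rewrite mulf_eq0 gt_eqF//= => /eqP xy0; apply/eqP; rewrite -subr_eq0 -normr_eq0.
by rewrite eq_le normr_ge0 andbT -xy0 norm_le_enorm.
Qed.

Lemma similarity_orth (c : R) (O : 'M[R]_d) (t : 'cV[R]_d) : 0 < c ->
  O^T *m O = 1%:M -> similarity c (fun x => c *: (O *m x) + t).
Proof.
move=> c0 OO; split=> [x y|y]; last first.
  exists (O^T *m (c^-1 *: (y - t))); rewrite mulmxA (mulmx1C OO) mul1mx.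
  by rewrite scalerA divff ?gt_eqF// scale1r subrK.
have -> : c *: (O *m x) + t - (c *: (O *m y) + t) = c *: (O *m (x - y)).
  by rewrite mulmxBr scalerBr opprD addrACA subrr addr0.
move: (x - y) => {x}{}y.
have dot (z : 'cV[R]_d) : \sum_(i < d) z i ord0 ^+ 2 = (z^T *m z) ord0 ord0.
  by rewrite mxE; apply: eq_bigr => i _; rewrite mxE expr2.
rewrite /enorm dot -[X in _ = X * _](ger0_norm (ltW c0)) -sqrtr_sqr.
rewrite -sqrtrM ?sqr_ge0// dot; congr Num.sqrt.
rewrite -scalemxAr linearZ/= -scalemxAl scalerA mxE -expr2; congr (_ * _).
by rewrite trmx_mul mulmxA -(mulmxA y^T) OO mulmx1.
Qed.

Lemma similarity_eball c f p (r : R) : 0 < c -> similarity c f ->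
  eball (f p) (c * r) `<=` f @` eball p r.
Proof.
move=> c0 [fe fs] y; have [x <-] := fs y.
by rewrite /eball/closed_ball_/= fe ler_pM2l// => xr; exists x.
Qed.

Lemma similarity_interior c f A : (0 < d)%N -> 0 < c -> similarity c f ->
  f @` interior A `<=` interior (f @` A).
Proof.
move=> d0 c0 [fe fs] _ [x /nbhs_ballP[e /= e0 xeA] <-].
have dR : 0 < d%:R :> R by rewrite ltr0n.
(* Topological balls are taken in the sup norm, while [f] scales the Euclidean norm; dividing by [d]
   pays for passing from one to the other. *)
apply/nbhs_ballP; exists (c * e / d%:R) => /=; first by rewrite divr_gt0 ?mulr_gt0.
move=> y; have [z <-] := fs y; rewrite -!ball_normE/= => fxz.
exists z => //; apply: xeA; rewrite -ball_normE/=.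
apply: (le_lt_trans (norm_le_enorm _)); rewrite -(ltr_pM2l c0) -fe.
by apply: (le_lt_trans (enorm_le_norm _)); rewrite mulrC -ltr_pdivlMr.
Qed.

End Similarity.

(** * Content by lattice points *)

Section Content.
Context {R : realType} {d : nat}.
Implicit Types (A B : set 'cV[R]_d) (v e : R).

Definition grid (a : 'cV[int]_d) (m : nat) : seq 'cV[int]_d :=
  [seq \col_i (a i ord0 + (t i : nat)%:Z) | t : {ffun 'I_d -> 'I_m}].

Lemma size_grid a m : size (grid a m) = (m ^ d)%N.
Proof. by rewrite size_map -cardE card_ffun !card_ord. Qed.

Lemma grid_uniq a m : uniq (grid a m).
Proof.
rewrite map_inj_uniq ?enum_uniq// => t u /matrixP tu; apply/ffunP => i.
by apply: val_inj; have := tu i ord0; rewrite !mxE => /addrI [].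
Qed.

Lemma mem_grid a m (z : 'cV[int]_d) :
  (z \in grid a m) <-> forall i, a i ord0 <= z i ord0 < a i ord0 + m%:Z.
Proof.
split=> [/mapP[t _ ->] i|zam].
  by rewrite mxE lerDl ltrD2l ltz_nat ltn_ord.
have zi i : (absz (z i ord0 - a i ord0) < m)%N.
  by move: (zam i); move: (z i ord0) (a i ord0) => u v; lia.
apply/mapP; exists [ffun i => Ordinal (zi i)]; rewrite ?mem_enum//.
apply/matrixP => i j; rewrite (ord1 j) !mxE ffunE/=; move: (zam i).
by move: (z i ord0) (a i ord0) => u v; lia.
Qed.

Definition lattice_point e (z : 'cV[int]_d) : 'cV[R]_d :=
  \col_i (e * (z i ord0)%:~R).

(* A lower bound on the inner content of [A], measured by counting points of fine
   cubic lattices: it is superadditive over disjoint sets with no measurability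
   argument. *)
Definition content_ge A v := exists2 e0, 0 < e0 & forall e, 0 < e <= e0 ->
  exists s : seq 'cV[int]_d, [/\ uniq s,
    forall z : 'cV[int]_d, z \in s -> A (lattice_point e z) & v <= e ^+ d * (size s)%:R].

Lemma content_ge_sub A B v : A `<=` B -> content_ge A v -> content_ge B v.
Proof.
move=> AB [e0 e00 Av]; exists e0 => // e /Av[s [us sA vs]].
by exists s; split => // z /sA /AB.
Qed.

Lemma content_ge_le A v w : w <= v -> content_ge A v -> content_ge A w.
Proof.
move=> wv [e0 e00 Av]; exists e0 => // e /Av[s [us sA vs]].
by exists s; split => //; exact: le_trans vs.
Qed.

Lemma content_ge0 A : content_ge A 0.
Proof.
by exists 1 => // e /andP[e0 _]; exists [::]; split; rewrite // mulr0.
Qed.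

Lemma content_geU A B v w : A `&` B = set0 ->
  content_ge A v -> content_ge B w -> content_ge (A `|` B) (v + w).
Proof.
move=> AB0 [e1 e10 Av] [e2 e20 Bw]; exists (Num.min e1 e2); first by rewrite lt_min e10.
move=> e; rewrite le_min => /and3P[e0 ee1 ee2].
have [|s [us sA vs]] := Av e; first by rewrite e0.
have [|t [ut tB wt]] := Bw e; first by rewrite e0.
exists (s ++ t); split.
- rewrite cat_uniq us ut andbT/=; apply/hasPn => z /tB Bz; apply/negP => /sA Az.
  by have : (A `&` B) (lattice_point e z) by []; rewrite AB0.
- by move=> z; rewrite mem_cat => /orP[/sA|/tB]; [left|right].
- by rewrite size_cat natrD mulrDr lerD.
Qed.

Lemma content_ge_bigcup (I : eqType) (s : seq I) (F : I -> set 'cV[R]_d) (v : I -> R) :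
  uniq s -> (forall i j, i \in s -> j \in s -> i != j -> F i `&` F j = set0) ->
  (forall i, i \in s -> content_ge (F i) (v i)) ->
  content_ge (\bigcup_(i in [set` s]) F i) (\sum_(i <- s) v i).
Proof.
elim: s => [|i s IH]; first by rewrite big_nil => *; exact: content_ge0.
move=> /=/andP[is_ us] dF Fv; rewrite big_cons.
apply: (@content_ge_sub (F i `|` \bigcup_(j in [set` s]) F j)).
  move=> x [Fx|[j /= js Fx]]; first by exists i; rewrite //= mem_head.
  by exists j; rewrite //= in_cons js orbT.
apply: content_geU.
- apply/seteqP; split => // x [Fix [j /= js Fjx]].
  have ij : i != j by apply: contraNneq is_ => ->.
  have := dF i j (mem_head _ _) _ ij; rewrite in_cons js orbT => /(_ isT).
  by move=> /seteqP[/(_ x) FF _]; apply: FF.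
- by apply: Fv; rewrite mem_head.
- apply: IH => // [j k js ks jk|j js]; first by apply: dF; rewrite // in_cons ?js ?ks orbT.
  by apply: Fv; rewrite in_cons js orbT.
Qed.

(** Along each axis the cube, of side [2 * r], contains at least [truncn (2 * r / e)] consecutive
    multiples of [e]. Rounding loses less than [e <= r] of the side, so length [r] is left. *)
Lemma content_ge_cube (x : 'cV[R]_d) (r : R) : 0 < r ->
  content_ge [set y | `|x - y| <= r] (r ^+ d).
Proof.
move=> r0; exists r => // e /andP[e0 er].
pose a : 'cV[int]_d := \col_i Num.ceil ((x i ord0 - r) / e).
pose m := Num.truncn (2 * r / e).
have h0 : 0 <= 2 * r / e by rewrite divr_ge0 ?mulr_ge0 ?ltW.
have /andP[m1 m2] := truncn_itv h0.
exists (grid a m); split; first exact: grid_uniq.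
- move=> z /mem_grid zam; apply: norm_le_coord; first exact: ltW.
  move=> i; rewrite !mxE; have /andP[] := zam i; rewrite mxE => az za.
  have c1 : (x i ord0 - r) / e <= (Num.ceil ((x i ord0 - r) / e))%:~R by exact: ceil_ge.
  have c2 : (Num.ceil ((x i ord0 - r) / e))%:~R < (x i ord0 - r) / e + 1.
    by have := ceilB1_lt ((x i ord0 - r) / e); rewrite intrB mulr1z; lra.
  have {}az : (Num.ceil ((x i ord0 - r) / e))%:~R <= (z i ord0)%:~R :> R by rewrite ler_int.
  have {}za : (z i ord0)%:~R + 1 <= (Num.ceil ((x i ord0 - r) / e))%:~R + m%:R :> R.
    by rewrite -[m%:R]/(m%:Z%:~R) -[1]/(1%:Z%:~R) -!intrD ler_int; lia.
  have b1 : x i ord0 - r <= e * (z i ord0)%:~R.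
    by rewrite -ler_pdivrMl// mulrC; lra.
  have b2 : e * (z i ord0)%:~R <= x i ord0 + r.
    rewrite -ler_pdivlMl// mulrC.
    have -> : (x i ord0 + r) / e = (x i ord0 - r) / e + 2 * r / e.
      by field; rewrite gt_eqF.
    rewrite -/m in m1; lra.
  by rewrite ler_norml; lra.
- rewrite size_grid natrX -exprMn lerXn2r ?nnegrE ?mulr_ge0 ?(ltW e0) ?(ltW r0)//.
  rewrite -ler_pdivrMl// mulrC; rewrite -/m -natr1 in m2.
  have : 1 <= r / e by rewrite ler_pdivlMr// mul1r.
  by rewrite -mulrA in m2; lra.
Qed.

(** One mesh [e <= r] suffices: along each axis the cube meets at most [2 * r / e + 1] multiples of
    [e], and [2 * r + e <= 3 * r]. *)
Lemma content_le_cube A (x : 'cV[R]_d) (r v : R) : 0 < r ->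
  (forall y, A y -> `|x - y| <= r) -> content_ge A v -> v <= (3 * r) ^+ d.
Proof.
move=> r0 Ar [e0 e00 Av]; pose e := Num.min e0 r.
have ee : 0 < e by rewrite lt_min e00.
have er : e <= r by rewrite ge_min lexx orbT.
have [|s [us sA]] := Av e; first by rewrite ee ge_min lexx.
move=> /le_trans; apply.
pose a : 'cV[int]_d := \col_i Num.ceil ((x i ord0 - r) / e).
pose m := (Num.truncn (2 * r / e)).+1.
have h0 : 0 <= 2 * r / e by rewrite divr_ge0 ?mulr_ge0 ?ltW.
have /andP[m1 m2] := truncn_itv h0.
have : (size s <= m ^ d)%N.
  rewrite -(size_grid a); apply: uniq_leq_size => // z /sA /Ar xz.
  apply/mem_grid => i; have := le_trans (coord_le_norm _ i) xz.
  rewrite !mxE ler_distlC => /andP[z1 z2].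
  have c1 : (x i ord0 - r) / e <= (Num.ceil ((x i ord0 - r) / e))%:~R by exact: ceil_ge.
  apply/andP; split.
    by rewrite ceil_le_int ler_pdivrMr// mulrC.
  rewrite -(@ltr_int R) intrD -[m%:~R]/(m%:R).
  have : (z i ord0)%:~R <= (x i ord0 - r) / e + 2 * r / e.
    have -> : (x i ord0 - r) / e + 2 * r / e = (x i ord0 + r) / e.
      by field; rewrite gt_eqF.
    by rewrite ler_pdivlMr// mulrC.
  rewrite -/m in m2; lra.
move=> sm; apply: (@le_trans _ _ ((e * m%:R) ^+ d)).
  by rewrite exprMn -natrX ler_wpM2l ?exprn_ge0 ?(ltW ee)// ler_nat.
rewrite lerXn2r ?nnegrE ?mulr_ge0 ?(ltW ee) ?(ltW r0)//.
have : e * (Num.truncn (2 * r / e))%:R <= 2 * r by rewrite -ler_pdivlMl// [leRHS]mulrC.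
by rewrite /m -natr1; lra.
Qed.

Lemma content_ge_eball (p : 'cV[R]_d) (r : R) : (0 < d)%N -> 0 < r ->
  content_ge (eball p r) ((r / d%:R) ^+ d).
Proof.
move=> d0 r0; have dR : 0 < d%:R :> R by rewrite ltr0n.
apply: content_ge_sub (content_ge_cube p (divr_gt0 r0 dR)) => y /= py.
by apply: le_trans (enorm_le_norm _) _; rewrite mulrC -ler_pdivlMr.
Qed.

End Content.

(** * Packing open sets with dyadic cells *)

Section DyadicCells.
Context {R : realType} {d : nat}.
Implicit Types (x y u : 'cV[R]_d) (m : nat) (c : nat * 'cV[int]_d).

(** Rounding up makes the cells open on the left and closed on the right, like [box]; those of one
    level partition the space. *)
Definition dyadic m y : 'cV[int]_d := \col_i Num.ceil (2 ^+ m * y i ord0).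

Definition cell c : set 'cV[R]_d := [set y | dyadic c.1 y = c.2].

(** The ceiling of [2 * a] is [2 * k] or [2 * k - 1], where [k] is the ceiling of [a], so it
    determines [k]. This makes dyadic cells nested. *)
Lemma ceil_double_inj (s t : R) :
  Num.ceil (2 * s) = Num.ceil (2 * t) -> Num.ceil s = Num.ceil t.
Proof.
have ceil2 (a : R) :
    (2 * Num.ceil a - 1 <= Num.ceil (2 * a) <= 2 * Num.ceil a)%R.
  have a1 := ceil_ge a; have a2 := ceilB1_lt a.
  have b1 := ceil_ge (2 * a); have b2 := ceilB1_lt (2 * a).
  move: a1 a2 b1 b2; move: (Num.ceil a) (Num.ceil (2 * a)) => k l.
  rewrite !intrB !mulr1z => a1 a2 b1 b2; apply/andP; split.
    suff : ((2 * k - 1 - 1)%:~R < l%:~R :> R) by rewrite ltr_int; lia.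
    by rewrite !intrB intrM !mulr1z; lra.
  suff : ((l - 1)%:~R < (2 * k)%:~R :> R) by rewrite ltr_int; lia.
  by rewrite intrB intrM !mulr1z; lra.
move=> st; have := ceil2 s; rewrite st; have := ceil2 t.
by move: (Num.ceil s) (Num.ceil t) (Num.ceil _) => i j k; lia.
Qed.

Lemma dyadic_coarsen m n u y :
  (m <= n)%N -> dyadic n u = dyadic n y -> dyadic m u = dyadic m y.
Proof.
move=> mn; rewrite -(subnK mn); elim: (n - m)%N => [//|k IH] uy.
apply: IH; apply/matrixP => i j; have /matrixP/(_ i j) := uy.
by rewrite !mxE addSn exprS -!mulrA; exact: ceil_double_inj.
Qed.

Definition cell_lo c : 'cV[R]_d := \col_i (((c.2 i ord0)%:~R - 1) / 2 ^+ c.1).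
Definition cell_hi c : 'cV[R]_d := \col_i ((c.2 i ord0)%:~R / 2 ^+ c.1).

Lemma cell_box c : cell c = box (cell_lo c) (cell_hi c).
Proof.
have p0 : 0 < 2 ^+ c.1 :> R by exact: exprn_gt0.
apply/seteqP; split => y /= yc.
  move=> i; rewrite !mxE ltr_pdivrMr// ler_pdivlMr// ![_ * 2 ^+ _]mulrC -yc mxE.
  by rewrite ceil_ge andbT; have := ceilB1_lt (2 ^+ c.1 * y i ord0); rewrite intrB mulr1z.
apply/matrixP => i j; rewrite (ord1 j) mxE; have := yc i.
rewrite !mxE ltr_pdivrMr// ler_pdivlMr// ![_ * 2 ^+ _]mulrC => /andP[y1 y2].
by apply/eqP; rewrite ceil_eq intrB mulr1z y1.
Qed.

Lemma cell_lo_le_hi c i : cell_lo c i ord0 <= cell_hi c i ord0.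
Proof. by rewrite !mxE ler_pM2r ?invr_gt0 ?exprn_gt0//; lra. Qed.

Lemma cell_volume c : box_volume (cell_lo c) (cell_hi c) = (2 ^- c.1) ^+ d.
Proof.
rewrite /box_volume (eq_bigr (fun=> 2 ^- c.1)); last first.
  by move=> i _; rewrite !mxE -mulrBl opprB addrC subrK mul1r.
by rewrite prodr_const card_ord.
Qed.

Lemma cell_diam c u y : cell c u -> cell c y -> `|u - y| <= 2 ^- c.1.
Proof.
have p0 : 0 < 2 ^+ c.1 :> R by exact: exprn_gt0.
have e : cell_hi c = cell_lo c + const_mx (2 ^- c.1).
  by apply/matrixP => i j; rewrite !mxE mulrBl mul1r subrK.
rewrite cell_box e => uc yc; apply: norm_le_coord; first by rewrite invr_ge0 ltW.
move=> i; have := uc i; have := yc i; rewrite [X in _ <= X]mxE.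
by rewrite [(const_mx _) _ _]mxE !mxE ler_norml; lra.
Qed.

Lemma cell_inner_eball c : exists p, eball p (2 ^- c.1 / 4) `<=` cell c.
Proof.
have p0 : 0 < 2 ^- c.1 :> R by rewrite invr_gt0 exprn_gt0.
(* The centre of the cell. A quarter of the side, rather than half, keeps the closed ball off the
   excluded faces. *)
exists (\col_i (((c.2 i ord0)%:~R - 2^-1) / 2 ^+ c.1)) => y py.
rewrite cell_box => i; have := le_trans (coord_le_norm _ i) (le_trans (norm_le_enorm _) py).
rewrite !mxE ler_distlC !mulrBl mul1r => /andP[y1 y2].
by apply/andP; split; lra.
Qed.

Lemma open_cell (V : set 'cV[R]_d) y : open V -> V y ->
  exists m, cell (m, dyadic m y) `<=` V.
Proof.
move=> oV Vy; have /nbhs_ballP[e /= e0 yeV] := open_nbhs_nbhs (conj oV Vy).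
have e1 : 0 <= e^-1 by rewrite invr_ge0 ltW.
have /andP[_ em] := truncn_itv e1.
exists (Num.truncn e^-1).+1 => u uc; apply: yeV; rewrite -ball_normE/=.
have := @cell_diam ((Num.truncn e^-1).+1, dyadic (Num.truncn e^-1).+1 y) y u erefl uc.
move=> /le_lt_trans; apply => /=; rewrite invf_plt ?posrE ?exprn_gt0//.
by apply: lt_trans em _; rewrite -natrX ltr_nat ltn_expl.
Qed.

(** The maximal dyadic cells inside [V] are disjoint and cover [V], hence [E]. They compete in the
    infimum that defines [lebesgueRd E], so their total volume exceeds [v], and finitely many of
    them already do. *)
Lemma open_dyadic_packing (V E : set 'cV[R]_d) (v : R) : (0 < d)%N ->
  open V -> E `<=` V -> (v%:E < lebesgueRd E)%E ->
  exists s : seq (nat * 'cV[int]_d), [/\ uniq s,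
    forall c, c \in s -> cell c `<=` V,
    forall c c', c \in s -> c' \in s -> c != c' -> cell c `&` cell c' = set0
    & v < \sum_(c <- s) (2 ^- c.1) ^+ d].
Proof.
move=> d0 oV EV vE.
(* [D] selects the maximal cells: no coarser dyadic cell around them lies in [V]. *)
pose D c := cell c `<=` V /\
  forall c', (c'.1 < c.1)%N -> cell c `<=` cell c' -> ~ cell c' `<=` V.
have Ddisj c c' : D c -> D c' -> c != c' -> cell c `&` cell c' = set0.
  wlog cc' : c c' / (c.1 <= c'.1)%N.
    move=> H Dc Dc' ne; have /orP[cc|cc] := leq_total c.1 c'.1; first exact: H.
    by rewrite setIC; apply: H; rewrite // eq_sym.
  move=> Dc Dc' /negP ne; apply/seteqP; split => // u [uc uc']; apply: ne.
  move: cc'; rewrite leq_eqVlt => /orP[/eqP cc'|cc'].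
    by apply/eqP; rewrite [c]surjective_pairing [c']surjective_pairing -uc -uc' cc'.
  exfalso; apply: (Dc'.2 c cc' _ Dc.1) => y yc'.
  by rewrite /cell/= -uc; apply: dyadic_coarsen (ltnW cc') _; rewrite yc' uc'.
have Dcov y : V y -> exists2 c, D c & cell c y.
  move=> /(open_cell oV) ex.
  have ex' : exists m, `[< cell (m, dyadic m y) `<=` V >].
    by have [m mV] := ex; exists m; apply/asboolP.
  case: (ex_minnP ex') => m /asboolP mV mmin; exists (m, dyadic m y) => //.
  split=> // c' /= c'm cc' c'V; have yc' := cc' _ erefl.
  suff /mmin : `[< cell (c'.1, dyadic c'.1 y) `<=` V >] by rewrite leqNgt c'm.
  by apply/asboolP; rewrite yc' -surjective_pairing.
(* A cover is indexed by [nat], so cells are enumerated by their codes. An index that codes no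
   maximal cell receives the degenerate box from 0 to 0, of volume 0 as [d > 0]. *)
pose g k : option (nat * 'cV[int]_d) :=
  if pickle_inv k is Some c then if `[< D c >] then Some c else None else None.
pose a k := oapp cell_lo 0 (g k); pose b k := oapp cell_hi 0 (g k).
pose vol k : R := oapp (fun c => (2 ^- c.1) ^+ d) 0 (g k).
have volE k : box_volume (a k) (b k) = vol k.
  rewrite /a /b /vol; case: (g k) => [c|]; first exact: cell_volume.
  by rewrite /= /box_volume (bigD1 (Ordinal d0))//= mxE subrr mul0r.
have vol0 k : 0 <= vol k.
  by rewrite /vol; case: (g k) => //= c; rewrite exprn_ge0// invr_ge0 exprn_ge0.
have [N vN] : exists N, v < \sum_(0 <= k < N) vol k.
  apply/not_existsP => H; move: vE; apply/negP; rewrite -leNgt.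
  apply: (@le_trans _ _ (\sum_(0 <= k <oo) (vol k)%:E)%E).
    apply: ereal_inf_lbound; exists a, b; split.
    - by move=> k i; rewrite /a /b; case: (g k) => [c|]//=; exact: cell_lo_le_hi.
    - move=> y /EV /Dcov[c Dc yc]; exists (choice.pickle c) => //.
      rewrite /a /b /g pickleK_inv; case: asboolP => // _ /=.
      by rewrite -cell_box.
    - by apply: congr_lim; apply/funext => n; apply: eq_bigr => k _; rewrite volE.
  apply: lime_le.
    by apply: is_cvg_nneseries => k _ _; rewrite lee_fin.
  apply: nearW => n; rewrite sumEFin lee_fin leNgt; apply/negP; exact: H.
exists (pmap g (iota 0 N)); split.
- have gK : ocancel g choice.pickle.
    move=> k; rewrite /g; case E1 : (pickle_inv k) => [c|]//=.
    by case: asboolP => //= _; have := @pickle_invK (nat * 'cV[int]_d)%type k; rewrite E1.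
  by apply: (pmap_uniq gK); exact: iota_uniq.
- move=> c; rewrite mem_pmap => /mapP[k _]; rewrite /g.
  by case: pickle_inv => // c'; case: asboolP => // -[? _] [->].
- have sD c : c \in pmap g (iota 0 N) -> D c.
    rewrite mem_pmap => /mapP[k _]; rewrite /g.
    by case: pickle_inv => // c'; case: asboolP => // ? [->].
  by move=> c c' /sD Dc /sD Dc'; exact: Ddisj.
- apply: (lt_le_trans vN); rewrite /index_iota subn0.
  elim: (iota 0 N) => [|k s IH]; first by rewrite !big_nil.
  by rewrite big_cons /= /vol; case: (g k) => [c|]/=; rewrite ?big_cons ?add0r ?lerD2l.
Qed.

(* Orthogonal maps do not preserve dyadic cells: transport the balls inscribed in
   the cells instead. *)
Lemma similarity_packing (f : 'cV[R]_d -> 'cV[R]_d) (k : R) (V E : set 'cV[R]_d)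
    (v : R) : (0 < d)%N -> 0 < k -> similarity k f ->
  open V -> E `<=` V -> (v%:E < lebesgueRd E)%E ->
  content_ge (f @` V) ((k / (4 * d%:R)) ^+ d * v).
Proof.
move=> d0 k0 sf oV EV /(open_dyadic_packing d0 oV EV)[s [us sV sdisj vs]].
have dR : 0 < d%:R :> R by rewrite ltr0n.
have q0 : 0 < k / (4 * d%:R) by rewrite divr_gt0// mulr_gt0.
apply: (@content_ge_le _ _ _ (\sum_(c <- s) (k * (2 ^- c.1 / 4) / d%:R) ^+ d)).
  rewrite -[leRHS](_ : (k / (4 * d%:R)) ^+ d * \sum_(c <- s) (2 ^- c.1) ^+ d = _).
    by rewrite ler_wpM2l ?exprn_ge0 ?ltW.
  rewrite big_distrr/=; apply: eq_bigr => c _; rewrite -exprMn; congr (_ ^+ _).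
  move: (2 ^- c.1) => t.
  by rewrite invfM; ring.
apply: (@content_ge_sub _ _ (\bigcup_(c in [set` s]) f @` (cell c))).
  by move=> _ [c /= cs [y yc <-]]; exists y => //; exact: sV cs _ yc.
apply: content_ge_bigcup => //.
  move=> c c' cs c's cc'; apply/seteqP; split => // _ [[y yc <-] [y' yc' /esym]].
  move=> /(similarity_inj k0 sf) yy'; have := sdisj _ _ cs c's cc'.
  by move=> /seteqP[/(_ y) + _]; apply; split => //; rewrite yy'.
move=> c cs; have [p pc] := cell_inner_eball c.
have r0 : 0 < 2 ^- c.1 / 4 :> R by rewrite divr_gt0 ?invr_gt0 ?exprn_gt0.
apply: content_ge_sub (content_ge_eball (f p) d0 (mulr_gt0 k0 r0)).
by apply: subset_trans (similarity_eball k0 sf) _; exact: image_subset.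
Qed.

End DyadicCells.

(** * Cardinalities bounded through duplicate-free sequences *)

Section Counting.
Context {R : realType} {T : choiceType}.
Implicit Types (A : set T) (s : seq T).

Lemma size_le_counting A s (B : R) : uniq s -> (forall x, x \in s -> A x) ->
  (counting A <= B%:E)%E -> (size s)%:R <= B.
Proof.
move=> us sA; rewrite /counting; case: asboolP => // finA; rewrite lee_fin.
apply: le_trans; rewrite ler_nat; apply: uniq_leq_size => // x /sA Ax.
by rewrite in_fset_set// inE.
Qed.

Lemma counting_le A (B : R) :
  (forall s, uniq s -> (forall x, x \in s -> A x) -> (size s)%:R <= B) ->
  (counting A <= B%:E)%E.
Proof.
move=> sB; rewrite /counting; case: asboolP => [finA|infA].
  rewrite lee_fin; apply: sB; first exact: fset_uniq.
  by move=> x; rewrite in_fset_set// inE.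
have [C CA nC] := infinite_set_fset (Num.truncn B).+1 infA.
have := sB C (fset_uniq C) CA; have /truncn_itv/andP[_] : 0 <= B.
  exact: le_trans (sB [::] isT _).
move=> Bn CB; have : (size C)%:R < (Num.truncn B).+1%:R :> R by exact: le_lt_trans Bn.
by rewrite ltr_nat ltnNge nC.
Qed.

(** The sets [P i] may overlap: they are removed from [s] one after the other, which is why the
    bound is assumed for every subsequence of elements of [s]. *)
Lemma size_le_cover (I : eqType) s (t : seq I) (P : I -> set T) (B : R) :
  uniq s ->
  (forall x, x \in s -> exists2 i, i \in t & P i x) ->
  (forall i s', i \in t -> uniq s' -> (forall x, x \in s' -> x \in s /\ P i x) ->
     (size s')%:R <= B) ->
  (size s)%:R <= B * (size t)%:R.
Proof.
elim: t s => [|i t IH] s us st tB.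
  case: s us st tB => [|x s] _ st _; first by rewrite mulr0.
  by have [] := st x (mem_head _ _).
rewrite -(count_predC (fun x => `[< P i x >]) s) natrD /= -natr1 mulrDr mulr1 addrC.
rewrite -!size_filter lerD//.
  apply: IH => [|x|j s' jt us' s's]; first exact: filter_uniq.
    rewrite mem_filter => /andP[/= /asboolP nPi /st[j]].
    by rewrite in_cons => /predU1P[->|jt Pj] //; exists j.
  apply: (tB j) => // [|x /s's[]]; first by rewrite in_cons jt orbT.
  by rewrite mem_filter => /andP[_ ->].
apply: (tB i); [exact: mem_head|exact: filter_uniq|move=> x].
by rewrite mem_filter => /andP[/asboolP Pix ->].
Qed.

End Counting.

(** * Cylinders *)

Section Cylinders.
Context {R : realType} {d : nat} (Phi : simseq R d).
Implicit Types (X : set 'cV[R]_d) (i : Delta Phi) (Q : cylinder Phi) (r : R).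

Lemma word_ratio_gt0 n (w : word Phi n) : 0 < word_ratio w.
Proof.
elim: n w => [//|n IH] [w j] /=.
by rewrite mulr_gt0//; have /andP[] := ratio_itv j.
Qed.

Lemma similarity_sim n (j : idx Phi n) : similarity (Defs.ratio j) (sim j).
Proof.
by have /andP[r0 _] := ratio_itv j; exact: similarity_orth _ r0 (orth_orthogonal _).
Qed.

Lemma similarity_word n (w : word Phi n) : similarity (word_ratio w) (word_sim w).
Proof.
elim: n w => [_|n IH [w j]] /=; first exact: similarity_id.
by apply: similarity_comp => //; exact: similarity_sim.
Qed.

Lemma word_prefix_dfwith i n (j : idx Phi n) m : (m <= n)%N ->
  word_prefix (eqtype.dfwith i j) m = word_prefix i m.
Proof.
elim: m => [//|m IH] mn /=; rewrite IH ?(ltnW mn)// dfwith_out//.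
by rewrite neq_ltn mn orbT.
Qed.

Lemma word_prefix_onto n (w : word Phi n) : exists i, word_prefix i n = w.
Proof.
have i0 : Delta Phi.
  move=> n'; have : (0 < #|idx Phi n'|)%N by exact: leq_trans (card_idx Phi n').
  by move=> /card_gt0P/cid[].
elim: n w => [|n IH] w; first by exists i0; case: w.
case: w => w j; have [i iw] := IH w; exists (eqtype.dfwith i j).
by rewrite /= word_prefix_dfwith// iw dfwith_in.
Qed.

Lemma word_prefix_trunc i j m n : (m <= n)%N ->
  word_prefix i n = word_prefix j n -> word_prefix i m = word_prefix j m.
Proof.
move=> mn; rewrite -(subnK mn); elim: (n - m)%N => [//|k IH].
by rewrite addSn => -[/IH].
Qed.

Lemma word_ratio_prefix_le i m n : (m <= n)%N ->
  word_ratio (word_prefix i n) <= word_ratio (word_prefix i m).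
Proof.
move=> mn; rewrite -(subnK mn); elim: (n - m)%N => [//|k IH].
rewrite addSn /=; apply: le_trans IH; rewrite ler_piMr//.
  by rewrite ltW// word_ratio_gt0.
by have /andP[_ /ltW] := ratio_itv (i (k + m)%N).
Qed.

Lemma word_image_prefix A i m n :
  (forall n (j : idx Phi n), sim j @` A `<=` A) -> (m <= n)%N ->
  word_sim (word_prefix i n) @` A `<=` word_sim (word_prefix i m) @` A.
Proof.
move=> sA mn; rewrite -(subnK mn); elim: (n - m)%N => [//|k IH].
rewrite addSn /=; apply: subset_trans IH => _ [x Ax <-].
by exists (sim (i (k + m)%N) x) => //; apply: sA; exists x.
Qed.

Lemma cylinderE Q i : cyl_set Q i -> Q = Tagged (word Phi) (word_prefix i (tag Q)).
Proof. by case: Q => n w; rewrite /cyl_set/= => ->. Qed.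

Lemma cyl_set_nonempty Q : cyl_set Q !=set0.
Proof. by have [i ?] := word_prefix_onto (tagged Q); exists i. Qed.

Lemma parent_prefix i n :
  parent (Tagged (word Phi) (word_prefix i n.+1)) = Tagged (word Phi) (word_prefix i n).
Proof. by []. Qed.

Lemma cyl_set_parent Q : cyl_set Q `<=` cyl_set (parent Q).
Proof. by case: Q => -[//|n] w i /=; rewrite /cyl_set/= => <-. Qed.

(** With a common sequence, one word is a prefix of the other. If it were a proper prefix, it would
    also be a prefix of the parent of the longer one, whose ratio would then be at most [r]. *)
Lemma scale_cut_disjoint r Q Q' : scale_cut r Q -> scale_cut r Q' ->
  Q != Q' -> cyl_set Q `&` cyl_set Q' = set0.
Proof.
wlog QQ' : Q Q' / (tag Q <= tag Q')%N.
  move=> H cQ cQ' ne; have /orP[l|l] := leq_total (tag Q) (tag Q'); first exact: H.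
  by rewrite setIC; apply: H; rewrite // eq_sym.
move=> cQ cQ' /negP ne; apply/seteqP; split => // i [/cylinderE iQ /cylinderE iQ'].
apply: ne; rewrite iQ iQ'; move: QQ' cQ cQ'; rewrite {}iQ {}iQ' /=.
rewrite leq_eqVlt => /predU1P[-> //|].
case: (tag Q') => // m nm [_ /andP[rn _]] [_ /andP[_]].
rewrite parent_prefix /rho /= ltNge => /negP; case.
by apply: le_trans rn; exact: word_ratio_prefix_le.
Qed.

Lemma osc_interior_invariant X : (0 < d)%N -> osc_set Phi X ->
  forall n (j : idx Phi n), sim j @` interior X `<=` interior X.
Proof.
move=> d0 [[_ _ sX] _ _] n j; apply: subset_trans (interiorS (sX n j)).
have /andP[r0 _] := ratio_itv j.
exact: similarity_interior d0 r0 (similarity_sim j).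
Qed.

(** At the first level [k] where the words differ, invariance of the interior puts both images
    inside those of the prefixes of length [k.+1]. The map of the common prefix is injective, so the
    separation at level [k] applies. *)
Lemma osc_disjoint X Q Q' : (0 < d)%N -> osc_set Phi X ->
  cyl_set Q `&` cyl_set Q' = set0 ->
  word_sim (tagged Q) @` interior X `&` word_sim (tagged Q') @` interior X = set0.
Proof.
move=> d0 oX; wlog QQ' : Q Q' / (tag Q <= tag Q')%N.
  move=> H ne; have /orP[l|l] := leq_total (tag Q) (tag Q'); first exact: H.
  by rewrite setIC; apply: H; rewrite // setIC.
have [i Qi] := cyl_set_nonempty Q; have [j Qj] := cyl_set_nonempty Q'.
move: Q Q' Qi Qj QQ' => [n w] [m w']; rewrite /cyl_set/= => <- <- nm H.
have ij : word_prefix i n <> word_prefix j n.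
  move=> ij; have : ([set: Delta Phi] `&` set0) j.
    split => //; rewrite -H; split; rewrite /cyl_set//=.
  by case.
have [k kn [ijk ijk']] : exists2 k, (k < n)%N &
    word_prefix i k = word_prefix j k /\ i k != j k.
  elim: n ij {w nm H} => [//|n IH] ij.
  have [e|/IH[k kn ?]] := pselect (word_prefix i n = word_prefix j n).
    by exists n => //; split=> //; apply/eqP => e'; apply: ij; rewrite /= e e'.
  by exists k => //; exact: ltnW.
have sU := osc_interior_invariant d0 oX.
apply/seteqP; split=> // x [].
move=> /(word_image_prefix sU kn)/= [u Uu <-].
move=> /(word_image_prefix sU (leq_trans kn nm))/= [v Uv]; rewrite -ijk.
move=> /(similarity_inj (word_ratio_gt0 _) (similarity_word _)) vu.
have [_ _ /(_ k _ _ ijk')/seteqP[/(_ (sim (i k) u)) + _]] := oX.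
by apply; split; [exists u|exists v].
Qed.

(** Parents of disjoint cylinders may be nested. Keeping only the parents with no proper prefix
    among the parents restores disjointness, and the shortest parent along a sequence of [Q] still
    contains [Q]. *)
Lemma maximal_parents (s : seq (cylinder Phi)) : (forall Q, Q \in s -> (0 < tag Q)%N) ->
  exists t : seq (cylinder Phi), [/\ uniq t,
    forall P, P \in t -> exists2 Q, Q \in s & P = parent Q,
    forall P P', P \in t -> P' \in t -> P != P' -> cyl_set P `&` cyl_set P' = set0
    & forall Q, Q \in s -> exists2 P, P \in t & cyl_set Q `<=` cyl_set P].
Proof.
move=> s0; pose pr i k := Tagged (word Phi) (word_prefix i k) : cylinder Phi.
pose top P := P \in map (@parent _ _ Phi) s /\
  forall i k, cyl_set P i -> (k < tag P)%N -> pr i k \notin map (@parent _ _ Phi) s.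
exists [seq P <- undup (map (@parent _ _ Phi) s) | `[< top P >]]; split.
- by rewrite filter_uniq// undup_uniq.
- by move=> P; rewrite mem_filter mem_undup => /andP[_ /mapP].
- move=> P P'; rewrite !mem_filter => /andP[/asboolP tP _] /andP[/asboolP tP' _].
  move: P P' tP tP' => P P'; wlog PP' : P P' / (tag P <= tag P')%N.
    move=> H tP tP' ne; have /orP[l|l] := leq_total (tag P) (tag P'); first exact: H.
    by rewrite setIC; apply: H; rewrite // eq_sym.
  move=> tP tP' /negP ne; apply/seteqP; split => // i [Pi P'i]; apply: ne.
  move: PP'; rewrite leq_eqVlt => /predU1P[PP'|PP'].
    by rewrite (cylinderE Pi) (cylinderE P'i) PP'.
  by have /negP[] := tP'.2 i (tag P) P'i PP'; rewrite /pr -(cylinderE Pi) tP.1.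
- move=> Q Qs; have [i Qi] := cyl_set_nonempty Q.
  have tQ : pr i (tag Q).-1 \in map (@parent _ _ Phi) s.
    apply/mapP; exists Q => //; rewrite (cylinderE Qi) /=.
    by case: (tag Q) (s0 _ Qs).
  have ex : exists k, pr i k \in map (@parent _ _ Phi) s by exists (tag Q).-1.
  case: (ex_minnP ex) => k kP kmin; exists (pr i k).
    rewrite mem_filter mem_undup kP andbT; apply/asboolP; split=> // j l ji lk.
    apply/negP => jP; have /kmin : pr i l \in map (@parent _ _ Phi) s.
      by rewrite /pr -(word_prefix_trunc (ltnW lk) ji).
    by rewrite leqNgt lk.
  move=> j Qj; have := kmin _ tQ => kQ.
  apply: (@word_prefix_trunc j i k (tag Q)); last by rewrite Qi Qj.
  by apply: leq_trans kQ _; exact: leq_pred.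
Qed.

Lemma homogeneous_word_ratio n (w w' : word Phi n) :
  homogeneous Phi -> word_ratio w = word_ratio w'.
Proof.
move=> hom; elim: n w w' => [//|n IH] [w j] [w' j'] /=.
by rewrite (IH w w'); have [q qE] := hom n; rewrite !qE.
Qed.

(** Ratios depend on the level only, so all cylinders of one cut have the same level: the parent of
    a longer one would have a ratio at most [r]. *)
Lemma homogeneous_scale_cut r Q Q' : homogeneous Phi ->
  scale_cut r Q -> scale_cut r Q' -> rho (parent Q) = rho (parent Q').
Proof.
move=> hom; wlog QQ' : Q Q' / (tag Q <= tag Q')%N.
  move=> H cQ cQ'; have /orP[l|l] := leq_total (tag Q) (tag Q'); first exact: H.
  by symmetry; exact: H.
have [i Qi] := cyl_set_nonempty Q; have [j Qj] := cyl_set_nonempty Q'.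
move: Q Q' Qi Qj QQ' => [[|n] w] [[|m] w']; rewrite /cyl_set/= => <- <- nm [//= _].
move=> /andP[rn _] [//= _ /andP[_ rm]].
move: nm; rewrite ltnS leq_eqVlt => /predU1P[nm|nm].
  by subst m; exact: homogeneous_word_ratio.
have := lt_le_trans rm (word_ratio_prefix_le j nm).
rewrite (homogeneous_word_ratio _ (word_prefix i n.+1) hom) => /lt_le_trans/(_ rn).
by rewrite ltxx.
Qed.

End Cylinders.

(** * The coding map and its approximation by cylinder images *)

Section Coding.
Context {R : realType} {d : nat} (Phi : simseq R d).
Implicit Types (X Y : set 'cV[R]_d) (i : Delta Phi) (Q : cylinder Phi) (r : R).

Lemma compact_enorm_bounded X Y : compact X -> compact Y ->
  exists2 D : R, 0 <= D & forall x y, X x -> Y y -> enorm (x - y) <= D.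
Proof.
move=> /compact_bounded[M [_ MX]] /compact_bounded[N [_ NY]].
have MX' x : X x -> `|x| <= `|M| + 1.
  by apply: MX; rewrite ltr_pwDr// ler_norm.
have NY' y : Y y -> `|y| <= `|N| + 1.
  by apply: NY; rewrite ltr_pwDr// ler_norm.
exists (d%:R * (`|M| + 1 + (`|N| + 1))).
  by rewrite mulr_ge0// !addr_ge0.
move=> x y Xx Yy; apply: le_trans (enorm_le_norm _) _; rewrite ler_wpM2l//.
by apply: le_trans (ler_normB _ _) _; rewrite lerD ?MX' ?NY'.
Qed.

(** [coding] is chosen by [xget], so the intersection must be shown non-empty to exclude the default
    0. A cluster point of the images of one point under the prefixes of [i] lies in it. *)
Lemma coding_mem X i n : (0 < d)%N -> invariant_compact Phi X ->
  (word_sim (word_prefix i n.+1) @` X) (coding X i).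
Proof.
move=> d0 [[x0 Xx0] cX sX].
pose y m := word_sim (word_prefix i m) x0.
have yX m : X (y m).
  have [z Xz <- //] : (word_sim (word_prefix i 0) @` X) (y m).
  by apply: (word_image_prefix sX (leq0n m)); exists x0.
have [p [Xp yp]] : X `&` cluster (y @ \oo) !=set0.
  by apply: cX; exists 0%N => // m _ /=; exact: yX.
suff : (\bigcap_n (word_sim (word_prefix i n.+1) @` X)) (coding X i).
  by move=> /(_ n I).
apply: (@xgetPex _ 0 (\bigcap_n (word_sim (word_prefix i n.+1) @` X))).
exists p => k _; set f := word_sim _.
have sf : similarity (word_ratio (word_prefix i k.+1)) f by exact: similarity_word.
have f0 := word_ratio_gt0 (word_prefix i k.+1).
have [q qp] := sf.2 p; exists q => //.
apply: (compact_closed (@norm_hausdorff _ _) cX) => B /nbhs_interior qB.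
have fB : interior (f @` B) (f q).
  by apply: (similarity_interior d0 f0 sf); exists q => //; exact: nbhs_singleton qB.
rewrite qp in fB; have [|_ [[u Xu <-] [v Bv]]] := yp (f @` X) (f @` B) _ fB.
  exists k.+1 => // m /= km; apply: (word_image_prefix sX km).
  by exists x0.
by move=> /(similarity_inj f0 sf) vu; exists u; split; rewrite // -vu.
Qed.

(* [Y], the set of the open set condition, need not be the set [X] that defines
   the coding map. *)
Lemma coding_near X Y i n r : (0 < d)%N -> nonautonomous_ifs Phi X ->
  invariant_compact Phi Y -> 0 < r ->
  exists2 z, Y z & enorm (coding X i - word_sim (word_prefix i n) z) <= r.
Proof.
move=> d0 [iX vX] [[y Yy] cY sY] r0; have [_ cX _] := iX.
have [D D0 XY] := compact_enorm_bounded cX cY.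
have e0 : 0 < r / (D + 1) by rewrite divr_gt0// ltr_pwDr.
move/cvgrPdist_lt : vX => /(_ _ e0)[N _ Nr].
(* The coding point and the image of [y] are compared through the same long word, whose ratio is at
   most [r / (D + 1)]; the 1 is added because [D] may be 0. *)
pose m := (maxn N n); have [x Xx <-] := coding_mem i m d0 iX.
have nm : (n <= m.+1)%N by rewrite ltnW// ltnS leq_maxr.
have [z Yz zy] : (word_sim (word_prefix i n) @` Y) (word_sim (word_prefix i m.+1) y).
  by apply: (word_image_prefix sY nm); exists y.
exists z => //; rewrite zy; have [-> _] := similarity_word (word_prefix i m.+1).
have : word_ratio (word_prefix i m.+1) <= r / (D + 1).
  have /Nr /= : (N <= m.+1)%N by rewrite ltnW// ltnS leq_maxl.
  rewrite sub0r normrN => /ltW; apply: le_trans; apply: le_trans (ler_norm _).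
  apply: ub_le_sup; last by exists (word_prefix i m.+1).
  exists 1 => _ [w _ <-]; have [j <-] := @word_prefix_onto _ _ Phi m.+1 w.
  exact: (@word_ratio_prefix_le _ _ Phi j 0 m.+1 (leq0n _)).
move=> rD; apply: (@le_trans _ _ (r / (D + 1) * D)).
  by rewrite ler_pM// ?enorm_ge0 ?XY// ltW// word_ratio_gt0.
by rewrite mulrAC ler_pdivrMr ?ltr_pwDr// ler_pM2l//; lra.
Qed.

End Coding.

(** * Counting neighbours *)

Section NeighbourhoodCount.
Context {R : realType} {d : nat} (Phi : simseq R d) (d0 : (0 < d)%N).
Implicit Types (X Y : set 'cV[R]_d) (Q P : cylinder Phi) (r : R).

(** One [r] is the distance from [x] to a coding point of [Q], the other the error in replacing that
    point by one of the image of [Y]. *)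
Lemma neighbours_near X Y x r Q P : nonautonomous_ifs Phi X ->
  invariant_compact Phi Y -> 0 < r -> neighbours X x r Q ->
  cyl_set Q `<=` cyl_set P ->
  exists2 z, Y z & `|x - word_sim (tagged P) z| <= 2 * r.
Proof.
move=> iX iY r0 [_ [_ [[i Qi <-] xr]]] QP.
have [z Yz zr] := coding_near i (tag P) d0 iX iY r0; exists z => //.
rewrite -(QP i Qi) -(subrKA (coding X i)); apply: le_trans (ler_normD _ _) _.
rewrite mulr_natl mulr2n lerD//; apply: le_trans (norm_le_enorm _) _ => //.
Qed.

(** Disjoint pieces of content [(k * rr) ^+ d] share a cube whose content is at most
    [(3 * rr) ^+ d]. *)
Lemma disjoint_cylinders_bound Y x (k rr : R) (t : seq (cylinder Phi)) :
  osc_set Phi Y -> 0 < k -> 0 < rr -> uniq t ->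
  (forall P P', P \in t -> P' \in t -> P != P' -> cyl_set P `&` cyl_set P' = set0) ->
  (forall P, P \in t ->
     content_ge (word_sim (tagged P) @` interior Y `&` [set y | `|x - y| <= rr])
       ((k * rr) ^+ d)) ->
  (size t)%:R <= (3 / k) ^+ d.
Proof.
move=> oY k0 rr0 ut tdisj tP; rewrite expr_div_n ler_pdivlMr ?exprn_gt0//.
rewrite -(@ler_pM2r _ (rr ^+ d)) ?exprn_gt0// -mulrA -!exprMn.
have -> : (size t)%:R * (k * rr) ^+ d = \sum_(P <- t) (k * rr) ^+ d.
  by rewrite big_const_seq count_predT iter_addr_0 mulr_natl.
pose F P := word_sim (tagged P) @` interior Y `&` [set y | `|x - y| <= rr].
apply: (@content_le_cube _ _ (\bigcup_(P in [set` t]) F P) x rr) => //.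
  by move=> y [P _ []].
apply: content_ge_bigcup => // P P' Pt P't PP'.
have := osc_disjoint d0 oY (tdisj _ _ Pt P't PP') => /seteqP[FF _].
by apply/seteqP; split => // y [[Fy _] [F'y _]]; apply: (FF y).
Qed.

(** Each image of the interior contains a ball of radius proportional to [rho P], and lies within
    [2 * r + rho P * D] of [x], where [D] bounds the diameter of [Y]. Since [A] is independent of
    [a] and [rr], both homogeneous systems and ratios bounded below are covered. *)
Lemma bounded_ratio_bound X Y : nonautonomous_ifs Phi X -> osc_set Phi Y ->
  exists2 A : R, 0 < A & forall x (a r rr : R) (t : seq (cylinder Phi)),
    0 < a -> 0 < r -> r <= rr -> uniq t ->
    (forall P P', P \in t -> P' \in t -> P != P' -> cyl_set P `&` cyl_set P' = set0) ->
    (forall P, P \in t -> a * rr <= rho P <= rr /\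
       exists2 Q, neighbours X x r Q & cyl_set Q `<=` cyl_set P) ->
    (size t)%:R <= (A / a) ^+ d.
Proof.
move=> iX oY; have [iY [z0 Yz0] _] := oY; have [_ cY _] := iY.
have dR : 0 < d%:R :> R by rewrite ltr0n.
have [D D0 YD] := compact_enorm_bounded cY cY.
have /nbhs_ballP[e /= e0 eY] : nbhs z0 (interior Y) by exact: nbhs_interior.
have D2 : 0 < 2 + D by lra.
exists (6 * d%:R * (2 + D) / e); first by rewrite divr_gt0// !mulr_gt0.
move=> x a r rr t a0 r0 rrr ut tdisj tP.
have rr0 : 0 < rr by exact: lt_le_trans rrr.
(* Chosen so that [k * ((2 + D) * rr)] equals [a * rr * (e / 2) / d], the side given by
   [content_ge_eball] for the image of a ball of radius [e / 2] when [rho P] is smallest. *)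
pose k := a * e / (2 * d%:R * (2 + D)).
have k0 : 0 < k by rewrite divr_gt0 ?mulr_gt0.
have -> : 6 * d%:R * (2 + D) / e / a = 3 / k.
  by rewrite /k; field; rewrite !gt_eqF.
apply: (@disjoint_cylinders_bound Y x k ((2 + D) * rr)) => //; first exact: mulr_gt0.
move=> P /tP[/andP[aP Pr] [Q xQ QP]].
have sP := similarity_word (tagged P); have rP := word_ratio_gt0 (tagged P).
have e2 : 0 < e / 2 by lra.
apply: (@content_ge_le _ _ _ ((rho P * (e / 2) / d%:R) ^+ d)).
  have kE : k * ((2 + D) * rr) = a * rr * (e / 2) / d%:R.
    by rewrite /k; field; rewrite !gt_eqF.
  have k1 : 0 < a * rr * (e / 2) / d%:R by rewrite divr_gt0// !mulr_gt0.
  have k2 : 0 < rho P * (e / 2) / d%:R by rewrite divr_gt0// !mulr_gt0.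
  rewrite kE lerXn2r ?nnegrE ?(ltW k1) ?(ltW k2)//.
  by rewrite ler_pM2r ?invr_gt0// ler_pM2r.
apply: content_ge_sub (content_ge_eball (word_sim (tagged P) z0) d0 (mulr_gt0 rP e2)).
move=> _ /(similarity_eball rP sP)[y yz <-].
have Yy : interior Y y.
  apply: eY; rewrite -ball_normE/=; apply: le_lt_trans (norm_le_enorm _) _.
  by apply: le_lt_trans yz _; lra.
split; first by exists y.
have [z Yz xz] := neighbours_near iX iY r0 xQ QP.
rewrite /= -(subrKA (word_sim (tagged P) z)); apply: le_trans (ler_normD _ _) _.
apply: (@le_trans _ _ (2 * r + rho P * D)).
  rewrite lerD//; apply: le_trans (norm_le_enorm _) _; rewrite sP.1.
  by rewrite ler_pM2l// YD//; exact: interior_subset.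
rewrite [leRHS]mulrDl; apply: lerD; first by rewrite ler_pM2l.
by rewrite [leLHS]mulrC ler_wpM2l.
Qed.

(** [rho P] has no upper bound in terms of [r], so only the part of the image near [x] is counted.
    Pulled back by the word map it has scale [r / rho P < 1], where the cone condition applies. *)
Lemma cone_bound X : nonautonomous_ifs Phi X -> cone_condition Phi ->
  exists2 A : R, 0 < A & forall x r (t : seq (cylinder Phi)),
    0 < r -> uniq t ->
    (forall P P', P \in t -> P' \in t -> P != P' -> cyl_set P `&` cyl_set P' = set0) ->
    (forall P, P \in t -> r < rho P /\
       exists2 Q, neighbours X x r Q & cyl_set Q `<=` cyl_set P) ->
    (size t)%:R <= A.
Proof.
move=> iX [Y oY cone]; have [iY _ _] := oY.
have dR : 0 < d%:R :> R by rewrite ltr0n.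
have [c /andP[c0 c1] coneE] : exists2 c : R, 0 < c <= 1 & forall z s, Y z -> 0 < s < 1 ->
    ((c * s ^+ d)%:E < lebesgueRd (eball z s `&` interior Y))%E.
  (* The infimum may be infinite a priori. Halving it gives the strict inequality that the packing
     needs; the cap at 1 gives [c ^+ d <= c] below. *)
  have [c c01 cc] : exists2 c : R, 0 < c <= 1 & (c%:E <
      ereal_inf [set ereal_inf [set (s ^- d)%:E * lebesgueRd (eball z s `&` interior Y)
        | s in [set s | (0 < s < 1)%R]] | z in Y])%E.
    move: cone; case: (ereal_inf _) => [c| |//].
      rewrite lte_fin => c0; exists (Num.min (c / 2) 1).
        by rewrite lt_min ge_min lexx orbT ltr01 !andbT; lra.
      by rewrite lte_fin gt_min; apply/orP; left; lra.
    by move=> _; exists 1; rewrite ?ltry// ltr01 lexx.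
  exists c => // z s Yz s01; have /andP[s0 _] := s01.
  rewrite EFinM muleC -lte_pdivlMl ?exprn_gt0//; apply: (lt_le_trans cc).
  apply: (@le_trans _ _ (ereal_inf [set (s ^- d)%:E * lebesgueRd (eball z s `&` interior Y)
        | s in [set s | (0 < s < 1)%R]])%E).
    by apply: ereal_inf_lbound; exists z.
  by apply: ereal_inf_lbound; exists s.
(* The image of [z] is within [2 * r] of [x]; points within [2 * s] of [z] in the sup norm are
   within [2 * d * s] in the Euclidean norm, which scales to [2 * d * r]. *)
pose b : R := 2 + 2 * d%:R; have b0 : 0 < b by rewrite /b; lra.
pose k := c / (4 * d%:R * b).
have k0 : 0 < k by rewrite divr_gt0// !mulr_gt0.
exists ((3 / k) ^+ d); first by rewrite exprn_gt0// divr_gt0.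
move=> x r t r0 ut tdisj tP.
apply: (@disjoint_cylinders_bound Y x k (b * r)) => //; first exact: mulr_gt0.
move=> P /tP[rP [Q xQ QP]].
have sP := similarity_word (tagged P); have P0 := word_ratio_gt0 (tagged P).
have [z Yz xz] := neighbours_near iX iY r0 xQ QP.
pose s := r / rho P; have s0 : 0 < s by rewrite divr_gt0.
have s1 : s < 1 by rewrite ltr_pdivrMr// mul1r.
(* The packing takes place in an open set, so the closed ball is enlarged to an open one of twice
   the radius. *)
pose V := ball z (2 * s) `&` interior Y.
have VE : eball z s `&` interior Y `<=` V.
  move=> y [zy Yy]; split=> //; rewrite -ball_normE/=.
  by apply: le_lt_trans (le_trans (norm_le_enorm _) zy) _; lra.
have oV : open V by apply: openI; [exact: ball_open|exact: open_interior].
have := similarity_packing d0 P0 sP oV VE (coneE z s Yz _).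
rewrite s0 s1 => /(_ isT) cV; apply: (@content_ge_le _ _ _ _ _ _ (content_ge_sub _ cV)).
  rewrite -/(rho P).
  have -> : (rho P / (4 * d%:R)) ^+ d * (c * s ^+ d) = c * (r / (4 * d%:R)) ^+ d.
    by rewrite mulrCA -exprMn /s; congr (_ * _ ^+ _); field; rewrite !gt_eqF.
  have -> : k * (b * r) = c * (r / (4 * d%:R)).
    by rewrite /k; field; rewrite !gt_eqF.
  rewrite exprMn ler_pM2r ?exprn_gt0 ?divr_gt0 ?mulr_gt0//.
  by rewrite -[leRHS]expr1 ler_wiXn2l// ltW.
move=> _ [y [zy Yy] <-]; split; first by exists y.
rewrite /= -(subrKA (word_sim (tagged P) z)); apply: le_trans (ler_normD _ _) _.
rewrite /b [leRHS]mulrDl; apply: lerD => //.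
apply: le_trans (norm_le_enorm _) _; rewrite sP.1.
move: zy; rewrite -ball_normE/= => zy.
apply: (@le_trans _ _ (word_ratio (tagged P) * (d%:R * (2 * s)))).
  rewrite ler_pM2l//; apply: le_trans (enorm_le_norm _) _.
  by rewrite ler_pM2l// ltW.
rewrite -/(rho P) /s le_eqVlt; apply/orP; left; apply/eqP.
by field; rewrite gt_eqF.
Qed.

Lemma bounded_branchingP : bounded_branching Phi ->
  exists2 B : R, 0 <= B & \forall r \near 0^'+,
    forall Q (s : seq (cylinder Phi)), scale_cut r Q -> uniq s ->
      (forall Q', Q' \in s -> scale_cut r Q' /\ cyl_set Q' `<=` cyl_set (parent Q)) ->
      (size s)%:R <= B.
Proof.
move=> /ereal_inf_lt[_ [W W0 <-] WB].
have [B B0 BW] : exists2 B : R, 0 <= B &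
    (ereal_sup (branching Phi @` W) <= B%:E)%E.
  move: WB; case: (ereal_sup _) => [B| //|] _; last by exists 0; rewrite ?leNye.
  by exists `|B|; rewrite ?lee_fin// ler_norm.
exists B => //; apply: filterS W0 => r Wr Q s rQ us sQ.
apply: (size_le_counting us sQ); apply: le_trans BW.
apply: (@le_trans _ _ (branching Phi r)); last by apply: ereal_sup_ubound; exists r.
by apply: ereal_sup_ubound; exists Q.
Qed.

Lemma bounded_neighbourhoodP X (B : R) :
  (\forall r \near 0^'+, forall x (s : seq (cylinder Phi)), uniq s ->
     (forall Q, Q \in s -> neighbours X x r Q) -> (size s)%:R <= B) ->
  bounded_neighbourhood_condition Phi X.
Proof.
move=> sB; apply: (@le_lt_trans _ _ B%:E); last exact: ltry.
apply: ge_ereal_inf; exists (ereal_sup ((fun r => ereal_sup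
    [set counting (@neighbours _ _ Phi X x r) | x in limit_set Phi X]) @` [set r | forall x
    (s : seq (cylinder Phi)), uniq s ->
     (forall Q, Q \in s -> neighbours X x r Q) -> (size s)%:R <= B])).
  by eexists; first exact: sB.
apply: ge_ereal_sup => _ [r rB <-]; apply: ge_ereal_sup => _ [x _ <-].
by apply: counting_le => s; exact: rB.
Qed.

(** Every neighbour lies in a maximal parent, and each of these, being the parent of a cylinder of
    the cut, contains at most [B] cylinders of the cut. *)
Lemma branching_reduction X (A : R) : bounded_branching Phi -> 0 <= A ->
  (forall x r (t : seq (cylinder Phi)), 0 < r -> uniq t ->
    (forall P P', P \in t -> P' \in t -> P != P' -> cyl_set P `&` cyl_set P' = set0) ->
    (forall P, P \in t -> exists Q, [/\ neighbours X x r Q, P = parent Q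
       & cyl_set Q `<=` cyl_set P]) ->
    (size t)%:R <= A) ->
  bounded_neighbourhood_condition Phi X.
Proof.
move=> /bounded_branchingP[B B0 nB] A0 tA.
apply: (@bounded_neighbourhoodP X (B * A)); near=> r => x s us sN.
have r0 : 0 < r by [].
have [|t [ut tpar tdisj tcov]] := @maximal_parents _ _ Phi s.
  by move=> Q /sN[[]].
apply: (@le_trans _ _ (B * (size t)%:R)).
  apply: (@size_le_cover _ _ _ s t (fun P => [set Q | cyl_set Q `<=` cyl_set P])) => //.
  move=> P s' /tpar[Q /sN[cQ _] ->] us' s's.
  have : forall Q (s : seq (cylinder Phi)), scale_cut r Q -> uniq s ->
      (forall Q', Q' \in s -> scale_cut r Q' /\ cyl_set Q' `<=` cyl_set (parent Q)) ->
      (size s)%:R <= B by near: r.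
  apply; [exact: cQ|exact: us'|] => Q' /s's[/sN[cQ' _] Q'Q].
  by split.
apply: ler_wpM2l => //; apply: (tA x r) => // P /tpar[Q Qs PQ]; exists Q.
by split; [exact: sN|exact: PQ|rewrite PQ; exact: cyl_set_parent].
Unshelve. all: by end_near. Qed.

End NeighbourhoodCount.

(** * The three sufficient conditions *)

Theorem theoremB (R : realType) (d : nat) (hd : (0 < d)%N) (Phi : simseq R d)
    (X : set 'cV[R]_d) (hPhi : nonautonomous_ifs Phi X)
    (hosc : open_set_condition Phi)
    (habc : (cone_condition Phi /\ bounded_branching Phi)
         \/ (homogeneous Phi /\ bounded_branching Phi)
         \/ ratios_bounded_below Phi) :
  bounded_neighbourhood_condition Phi X.
Proof.
have [Y oY] := hosc; have [A A0 bA] := bounded_ratio_bound hd hPhi oY.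
case: habc => [[cone bb]|[[hom bb]|[q q0 qr]]].
- have [C C0 bC] := cone_bound hd hPhi cone.
  apply: (branching_reduction bb (ltW C0)) => x r t r0 ut tdisj tP.
  apply: (bC x r t r0 ut tdisj) => P /tP[Q [xQ PQ QP]].
  by split; [rewrite PQ; have [[_ /andP[_]]] := xQ|exists Q].
- apply: (@branching_reduction _ _ _ X (A ^+ d) bb).
    by rewrite exprn_ge0// ltW.
  move=> x r [|P0 t] r0 ut tdisj tP; first by rewrite exprn_ge0// ltW.
  have [Q0 [[cQ0 _] PQ0 _]] := tP P0 (mem_head _ _).
  (* All parents share the ratio of [P0], which exceeds [r], so [a = 1] works at the scale
     [rho P0]. *)
  rewrite -[A]divr1; apply: (bA x 1 r (rho P0)) => //.
    by rewrite PQ0; have [_ /andP[_ /ltW]] := cQ0.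
  move=> P /tP[Q [xQ PQ QP]]; split; last by exists Q.
  have [cQ _] := xQ.
  by rewrite mul1r PQ0 PQ (homogeneous_scale_cut hom cQ0 cQ) lexx.
- apply: (@bounded_neighbourhoodP _ _ _ X ((A / q) ^+ d)); near=> r => x s us sN.
  have r0 : 0 < r by [].
  (* Each neighbour serves as its own [P]: its ratio is at most [r] and, its parent having ratio
     above [r], at least [q * r]. *)
  apply: (bA x q r r) => //.
    by move=> Q Q' /sN[cQ _] /sN[cQ' _]; exact: (scale_cut_disjoint cQ cQ').
  move=> Q /sN xQ; split; last by exists Q.
  have [[]] := xQ; case: Q {xQ} => -[//|n] [w j] /= _ /andP[-> rw] _.
  rewrite andbT /rho /= [leRHS]mulrC.
  exact: ler_pM (ltW q0) (ltW r0) (qr _ _) (ltW rw).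
Unshelve. all: by end_near. Qed.
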